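(* Let $R$ be a principal ideal domain, $S=R[x_1,\dots,x_n]$, and let $M$ be a finitely generated $S$-module. Then $M$ admits a free $S$-resolution $$0\to F_p\to F_{p-1}\to\dots\to F_1\to F_0\to M\to 0$$ of length $p\le n+1$. *)

(* Defs.v *)
From HB Require Import structures.
From mathcomp Require Import all_boot all_order all_algebra.
From mathcomp Require Import mpoly.

Set Implicit Arguments.
Unset Strict Implicit.
Unset Printing Implicit Defensive.

Import GRing.Theory.
Local Open Scope ring_scope.

(* Ideals are Prop-valued, so that arbitrary ideals are covered and not only
   the decidable ones; unlike MathComp's idealr_closed, they may be improper. *)
Definition is_ideal (R : comNzRingType) (I : R -> Prop) : Prop :=
  [/\ I 0,
      forall a b : R, I a -> I b -> I (a + b)
    & forall c a : R, I a -> I (c * a)].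

(* Being an integral domain is already part of idomainType. *)
Definition is_pid (R : idomainType) : Prop :=
  forall I : R -> Prop, is_ideal I ->
    exists a : R, forall x : R, I x <-> exists c : R, x = c * a.

Definition spans (S : nzRingType) (M : lmodType S) (m : nat)
    (b : 'I_m -> M) : Prop :=
  forall x : M, exists c : 'I_m -> S, x = \sum_(i < m) c i *: b i.

Definition lin_indep (S : nzRingType) (M : lmodType S) (m : nat)
    (b : 'I_m -> M) : Prop :=
  forall c : 'I_m -> S,
    \sum_(i < m) c i *: b i = 0 -> forall i : 'I_m, c i = 0.

Definition finitely_generated (S : nzRingType) (M : lmodType S) : Prop :=
  exists (m : nat) (b : 'I_m -> M), spans b.

Definition finite_free (S : nzRingType) (M : lmodType S) : Prop :=
  exists (m : nat) (b : 'I_m -> M), spans b /\ lin_indep b.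

(* The complex 0 -> F p -> ... -> F 0 -> M -> 0 is indexed by all of nat, the
   modules F i with i > p being zero.  Exactness at F p then says that
   F p -> F p.-1 (or F 0 -> M when p = 0) is injective. *)
Definition is_free_resolution (S : nzRingType) (M : lmodType S) (p : nat)
    (F : nat -> lmodType S) (d : forall i : nat, {linear F i.+1 -> F i})
    (eps : {linear F 0%N -> M}) : Prop :=
  [/\ forall i : nat, (i <= p)%N -> finite_free (F i),
      forall i : nat, (p < i)%N -> forall x : F i, x = 0,
      forall y : M, exists x : F 0%N, eps x = y,
      forall x : F 0%N, eps x = 0 <-> exists z : F 1%N, d 0%N z = x
    & forall (i : nat) (x : F i.+1),
        d i x = 0 <-> exists z : F i.+2, d i.+1 z = x].

(* Main.v *)
Require Import Defs.
From HB Require Import structures.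
From mathcomp Require Import all_boot all_order all_algebra.
From mathcomp Require Import mpoly.
From mathcomp Require Import zify.

(** Call [k] a bound for a ring [A] when every submodule of every [A^m] has a
    resolution by at most [k] free modules of finite rank.  The theorem follows
    from three facts: [1] is a bound for a principal ideal domain; if [k > 0] is
    a bound for [A] then [k + 1] is one for [A[x]]; and a finitely generated
    module is [S^r] modulo a submodule, hence needs one free module more than
    the submodule does.

    The second fact is where the work lies.  Let [N] be a submodule of [A[x]^m]
    and let [N_d] be the [A]-module of its elements of degree less than [d].  It
    sits in the free [A]-module [A^(d*m)].  The leading coefficients of the
    elements of [N] of degree at most [d] form an increasing chain of submodules
    of [A^m], which is stationary from some [D] on, because the bound for [A]
    contains the fact that submodules are finitely generated.  Then the elements
    of degree at most [D] generate [N], and all relations between them follow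
    from the obvious ones, that [x] times the generator [g] is the generator
    [x g], for [g] in [N_D]:
<<
      0 -> A[x] (x) N_D -> A[x] (x) N_(D+1) -> N -> 0
>>
    is exact, the first map being [p (x) g |-> x p (x) g - p (x) x g]
    ([shift_exact]).  The two tensor products inherit resolutions by [k] free
    modules from [A] ([has_res_extend]), and a mapping cone gives one by [k + 1]
    free modules for [N] ([has_res_quotient]).  As only free modules ever occur,
    there is no need to know that projective modules are free.

    Resolutions are handled as iterated presentations: a surjection from a free
    module together with a resolution of its kernel.  Submodules are predicates
    on an ambient module, and tensoring with [A[x]] amounts to considering the
    matrices over [A[x]] whose coefficients all lie in the given submodule. *)

Set Implicit Arguments.
Unset Strict Implicit.

Import GRing.Theory.
Local Open Scope ring_scope.

(** * Submodules and their free resolutions *)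

Definition submodule {S : comNzRingType} {V : lmodType S} (N : V -> Prop) :=
  N 0 /\ forall (a : S) u v, N u -> N v -> N (a *: u + v).

Lemma submodule_sum (S : comNzRingType) (V : lmodType S) (N : V -> Prop) s
    (a : 'I_s -> S) (v : 'I_s -> V) :
  submodule N -> (forall i, N (v i)) -> N (\sum_i a i *: v i).
Proof.
move=> [N0 ND] Nv; elim/big_rec: _ => // i u _; exact: ND.
Qed.

Lemma submoduleD (S : comNzRingType) (V : lmodType S) (N : V -> Prop) u v :
  submodule N -> N u -> N v -> N (u + v).
Proof. by move=> [_ ND] Nu Nv; rewrite -[u]scale1r; apply: ND. Qed.

Lemma submoduleZ (S : comNzRingType) (V : lmodType S) (N : V -> Prop) a u :
  submodule N -> N u -> N (a *: u).
Proof. by move=> [N0 ND] Nu; rewrite -[_ *: u]addr0; apply: ND. Qed.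

Lemma submoduleB (S : comNzRingType) (V : lmodType S) (N : V -> Prop) u v :
  submodule N -> N u -> N v -> N (u - v).
Proof. by move=> [_ ND] Nu Nv; rewrite addrC -scaleN1r; apply: ND. Qed.

(** Here [k] counts the free modules, so that a resolution of length [p] is
    [has_res p.+1]; starting the count at the zero module gives the inductions
    on [k] a trivial base case. *)
Fixpoint has_res {S : comNzRingType} (k : nat) {V : lmodType S}
    (N : V -> Prop) : Prop :=
  if k is k'.+1 then
    exists (r : nat) (f : {linear 'rV[S]_r -> V}),
      (forall v, N v <-> exists u, f u = v) /\ has_res k' (fun u => f u = 0)
  else forall v, N v <-> v = 0.

(** For [k > 0] this includes the finite generation of all submodules of
    [A^m], hence the noetherianity of the ring. *)
Definition all_res (k : nat) (S : comNzRingType) : Prop :=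
  forall (m : nat) (N : 'rV[S]_m -> Prop), submodule N -> has_res k N.

Lemma has_res_ext (S : comNzRingType) k (V : lmodType S) (N N' : V -> Prop) :
  (forall v, N v <-> N' v) -> has_res k N -> has_res k N'.
Proof.
case: k => [|k] eN /=; first by move=> N0 v; rewrite -eN.
by move=> [r [f [Nf res_f]]]; exists r, f; split=> // v; rewrite -eN.
Qed.

Lemma has_res_inj (S : comNzRingType) k (V V' : lmodType S)
    (g : {linear V -> V'}) (N : V -> Prop) (N' : V' -> Prop) :
  (forall v, N v -> g v = 0 -> v = 0) ->
  (forall v', N' v' <-> exists v, N v /\ g v = v') ->
  has_res k N -> has_res k N'.
Proof.
case: k => [|k] inj_g eN' /=.
  move=> N0 v'; rewrite eN'; split=> [[v [/N0-> <-]]|->]; first exact: linear0.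
  by exists 0; rewrite linear0 N0.
move=> [r [f [Nf res_f]]]; exists r, (g \o f); split=> [v'|].
  rewrite eN'; split=> [[v [/Nf[u <-] <-]]|[u <-]]; first by exists u.
  by exists (f u); split=> //; apply/Nf; exists u.
apply: has_res_ext res_f => u /=; split=> [->|]; first exact: linear0.
by apply: inj_g; apply/Nf; exists u.
Qed.

Lemma has_resS (S : comNzRingType) k (V : lmodType S) (N : V -> Prop) :
  has_res k N -> has_res k.+1 N.
Proof.
elim: k V N => [|k IHk] V N.
  move=> N0; exists 0, (\0 : {linear 'rV[S]_0 -> V}); split=> [v|v] /=.
    by rewrite N0; split=> [->|[_ <-]] //; exists 0.
  by rewrite (thinmx0 v).
by move=> [r [f [Nf /IHk res_f]]]; exists r, f.
Qed.

Lemma has_res_free_sum (S : comNzRingType) k p q (N : 'rV[S]_q -> Prop) :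
  has_res k.+1 N ->
  has_res k.+1 (fun v : 'rV[S]_(p + q) => N (rsubmx v)).
Proof.
move=> [r [f [Nf res_f]]].
exists (p + r)%N, (mulmxr (block_mx 1%:M 0 0 (lin1_mx f))).
have fE (u : 'rV_(p + r)) : u *m block_mx 1%:M 0 0 (lin1_mx f)
    = row_mx (lsubmx u) (f (rsubmx u)).
  rewrite -[u in LHS]hsubmxK mul_row_block !mulmx0 mulmx1 addr0 add0r.
  by rewrite mul_rV_lin1.
split=> [v|].
  rewrite Nf; split=> [[u fu]|[u <-]]; last first.
    by rewrite /= fE row_mxKr; exists (rsubmx u).
  by exists (row_mx (lsubmx v) u); rewrite /= fE row_mxKl row_mxKr fu hsubmxK.
apply: (has_res_inj (g := mulmxr (row_mx 0 1%:M)) _ _ res_f).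
  by move=> v _ /=; rewrite mul_mx_row mulmx1 mulmx0 -row_mx0 => /eq_row_mx[].
move=> v; rewrite /= fE -row_mx0; split=> [/eq_row_mx[v0 fv]|[u [fu <-]]].
  by exists (rsubmx v); rewrite /= mul_mx_row mulmx1 mulmx0 -v0 hsubmxK.
by rewrite /= mul_mx_row mulmx1 mulmx0 row_mxKl row_mxKr fu.
Qed.

(** Free modules are projective; the lift is given by a matrix so that it can be
    used as a block of another one. *)
Lemma free_lift (S : comNzRingType) r s (V : lmodType S)
    (f : {linear 'rV[S]_r -> V}) (g : {linear 'rV[S]_s -> V}) :
  (forall u, exists w, g w = f u) ->
  exists C : 'M[S]_(r, s), forall u, g (u *m C) = f u.
Proof.
move=> fg; have /fin_all_exists[c gc] i := fg (delta_mx 0 i).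
exists (\matrix_i c i) => u; rewrite mulmx_sum_row [in RHS](row_sum_delta u).
by rewrite !linear_sum; apply: eq_bigr => i _; rewrite !linearZ /= rowK gc.
Qed.

(** The mapping cone, for an exact sequence [0 -> N1 -> N0 -> N -> 0].  Choose
    presentations [f1] and [f0] of [N1] and [N0] and lift [phi \o f1] through
    [f0] to a matrix [C].  Then [psi \o f0] presents [N], and its kernel is the
    sum of the image of [C] and of the kernel of [f0].  That kernel is
    [(S^r1 (+) ker f0) / ker f1], with [ker f1] embedded by [w |-> (w, - w C)],
    so the same statement for the shorter resolutions of the kernels of [f1]
    and [f0] applies. *)
Lemma has_res_quotient (S : comNzRingType) k (V1 V0 V : lmodType S)
    (phi : {linear V1 -> V0}) (psi : {linear V0 -> V})
    (N1 : V1 -> Prop) (N0 : V0 -> Prop) (N : V -> Prop) :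
  (forall u, N1 u -> phi u = 0 -> u = 0) ->
  (forall v, N0 v /\ psi v = 0 <-> exists u, N1 u /\ phi u = v) ->
  (forall w, N w <-> exists v, N0 v /\ psi v = w) ->
  has_res k N1 -> has_res k.+1 N0 -> has_res k.+1 N.
Proof.
elim: k => [|k IHk] in V1 V0 V phi psi N1 N0 N * => inj_phi exact0 onto_psi.
  move=> N10; apply: has_res_inj onto_psi => v N0v psiv.
  have [u [/N10-> <-]] : exists u, N1 u /\ phi u = v by apply/exact0.
  exact: linear0.
move=> [r1 [f1 [N1f res_f1]]] [r0 [f0 [N0f res_f0]]].
exists r0, (psi \o f0); split=> [w|].
  rewrite onto_psi; split=> [[v [/N0f[u <-] <-]]|[u <-]]; first by exists u.
  by exists (f0 u); split=> //; apply/N0f; exists u.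
(* The lift exists because [phi] maps [N1], the image of [f1], into [N0]. *)
have [C fC] : exists C : 'M_(r1, r0), forall u, f0 (u *m C) = (phi \o f1) u.
  apply: free_lift => u; apply/N0f.
  have [] // : N0 (phi (f1 u)) /\ psi (phi (f1 u)) = 0.
  by apply/exact0; exists (f1 u); split=> //; apply/N1f; exists u.
have psif1 u : psi (phi (f1 u)) = 0.
  have [] // : N0 (phi (f1 u)) /\ psi (phi (f1 u)) = 0.
  by apply/exact0; exists (f1 u); split=> //; apply/N1f; exists u.
apply: (IHk _ _ _ (mulmxr (row_mx 1%:M (- C))) (mulmxr (col_mx C 1%:M)) _ _ _
  _ _ _ res_f1 (has_res_free_sum r1 res_f0)) => [u _||] /=.
- by rewrite mul_mx_row mulmx1 -row_mx0 => /eq_row_mx[].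
- move=> v; rewrite -{1 2}[v]hsubmxK mul_row_col mulmx1 row_mxKr.
  split=> [[f0v /eqP]|[u [f1u <-]]].
    rewrite addrC addr_eq0 => /eqP v2; exists (lsubmx v); split.
      apply: inj_phi; first by apply/N1f; exists (lsubmx v).
      by rewrite -/((phi \o f1) _) -fC -[_ *m C]opprK linearN /= -v2 f0v oppr0.
    by rewrite mul_mx_row mulmx1 mulmxN -v2 hsubmxK.
  rewrite mul_mx_row mulmx1 mulmxN row_mxKl row_mxKr linearN /= fC /= f1u.
  by rewrite linear0 oppr0 subrr.
move=> u; split=> [psifu|[v [f0v <-]]].
  have [_ [/N1f[w <-] phiw]] : exists t, N1 t /\ phi t = f0 u.
    by apply/exact0; split=> //; apply/N0f; exists u.
  exists (row_mx w (u - w *m C)); rewrite row_mxKr mul_row_col mulmx1.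
  by rewrite linearB /= fC /= phiw subrr addrC subrK.
rewrite -[v in LHS]hsubmxK mul_row_col mulmx1 linearD /= linearD /= f0v linear0.
by rewrite addr0 fC /= psif1.
Qed.

(** * Flat base change *)

(** The image of [B (x) N] in [B^q]. *)
Definition extend {A B : comNzRingType} (phi : {rmorphism A -> B}) {q}
    (N : 'rV[A]_q -> Prop) (v : 'rV[B]_q) : Prop :=
  exists s (b : 'I_s -> B) (u : 'I_s -> 'rV[A]_q),
    (forall i, N (u i)) /\ v = \sum_i b i *: map_mx phi (u i).

(** The equational criterion of flatness: the solutions over [B] of a linear
    system over [A] are generated by the solutions over [A]. *)
Definition flat {A B : comNzRingType} (phi : {rmorphism A -> B}) : Prop :=
  forall r q (C : 'M[A]_(r, q)) (w : 'rV[B]_r),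
    w *m map_mx phi C = 0 -> extend phi (fun u => u *m C = 0) w.

(** The matrix of a presentation of [N], read over [B], presents [extend phi N],
    and flatness identifies its kernel with the extension of the kernel. *)
Lemma has_res_extend (A B : comNzRingType) (phi : {rmorphism A -> B}) k q
    (N : 'rV[A]_q -> Prop) :
  flat phi -> has_res k N -> has_res k (extend phi N).
Proof.
move=> flat_phi; elim: k => [|k IHk] /= in q N *.
  move=> N0 v; split=> [[s [b [u [Nu ->]]]]|->].
    by rewrite big1 // => i _; have /N0-> := Nu i; rewrite map_mx0 scaler0.
  exists 0, (fun=> 0), (fun=> 0); rewrite big_ord0.
  by split=> // i; apply/N0.
move=> [r [f [Nf res_f]]].
exists r, (mulmxr (map_mx phi (lin1_mx f))); split=> [v|].
  split=> [[s [b [u [Nu ->]]]]|[w <-]].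
    have /fin_all_exists[t ft] i : exists t, f t = u i by apply/Nf.
    exists (\sum_i b i *: map_mx phi (t i)); rewrite /= mulmx_suml.
    apply: eq_bigr => i _.
    by rewrite -scalemxAl -map_mxM mul_rV_lin1 ft.
  exists r, (w 0), (fun i => row i (lin1_mx f)); split=> [i|].
    by apply/Nf; exists (delta_mx 0 i); rewrite rowE mul_rV_lin1.
  by rewrite /= mulmx_sum_row; apply: eq_bigr => i _; rewrite map_row.
apply: has_res_ext (IHk _ _ res_f) => w /=.
split=> [[s [b [u [fu ->]]]]|/flat_phi[s [b [u [fu ->]]]]].
  rewrite mulmx_suml big1 // => i _.
  by rewrite -scalemxAl -map_mxM mul_rV_lin1 fu map_mx0 scaler0.
by exists s, b, u; split=> // i; rewrite -mul_rV_lin1.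
Qed.

(** * Matrices of polynomials and their coefficients *)

Notation coef_mx j := (map_mx (coefp j)).
Notation const_poly_mx := (map_mx polyC).

Lemma coef_mx_const (A : nzRingType) m n j (U : 'M[A]_(m, n)) :
  coef_mx j (const_poly_mx U) = if j == 0%N then U else 0.
Proof.
by apply/matrixP => i k; case: j => [|j]; rewrite !mxE /= ?coefC.
Qed.

Lemma coef_mxXn (A : nzRingType) m n i j (W : 'M[{poly A}]_(m, n)) :
  coef_mx j ('X^i *: W) = if (j < i)%N then 0 else coef_mx (j - i) W.
Proof.
by apply/matrixP => a b; case: ifP => lt_ji; rewrite !mxE /= coefXnM lt_ji.
Qed.

Lemma coef_mx_constM (A : comNzRingType) m n p j (P : 'M[A]_(m, n))
    (W : 'M[{poly A}]_(n, p)) :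
  coef_mx j (const_poly_mx P *m W) = P *m coef_mx j W.
Proof.
apply/matrixP => a b; rewrite !mxE /= coef_sum; apply: eq_bigr => i _.
by rewrite !mxE coefCM.
Qed.

Lemma coef_mxMconst (A : comNzRingType) m n p j (P : 'M[A]_(n, p))
    (W : 'M[{poly A}]_(m, n)) :
  coef_mx j (W *m const_poly_mx P) = coef_mx j W *m P.
Proof.
apply/matrixP => a b; rewrite !mxE /= coef_sum; apply: eq_bigr => i _.
by rewrite !mxE coefMC.
Qed.

Lemma coef_mxD (A : nzRingType) m n j (W W' : 'M[{poly A}]_(m, n)) :
  coef_mx j (W + W') = coef_mx j W + coef_mx j W'.
Proof. exact: map_mxD. Qed.

Lemma coef_mxB (A : nzRingType) m n j (W W' : 'M[{poly A}]_(m, n)) :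
  coef_mx j (W - W') = coef_mx j W - coef_mx j W'.
Proof. exact: map_mxB. Qed.

Lemma coef_mx_eq0 (A : nzRingType) m n (W : 'M[{poly A}]_(m, n)) :
  (forall j, coef_mx j W = 0) -> W = 0.
Proof.
move=> W0; apply/matrixP => a b; apply/polyP => j.
by have /matrixP/(_ a b) := W0 j; rewrite !mxE coef0.
Qed.

Lemma coef_mx_bound (A : nzRingType) m n (W : 'M[{poly A}]_(m, n)) :
  exists s, forall j, (s <= j)%N -> coef_mx j W = 0.
Proof.
exists (\max_a \max_b size (W a b)) => j le_j.
apply/matrixP => a b; rewrite !mxE /= nth_default //; apply: leq_trans le_j.
by apply: leq_trans (leq_bigmax a); rewrite (leq_bigmax b).
Qed.

Lemma poly_mx_expand (A : nzRingType) m n (W : 'M[{poly A}]_(m, n)) s :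
  (forall j, (s <= j)%N -> coef_mx j W = 0) ->
  W = \sum_(j < s) 'X^j *: const_poly_mx (coef_mx j W).
Proof.
move=> Ws; apply/matrixP => a b; rewrite summxE.
rewrite (eq_bigr (fun j : 'I_s => (W a b)`_j *: 'X^j)) => [|j _]; last first.
  by rewrite !mxE /= -mul_polyC commr_polyXn.
apply/polyP => i; rewrite -poly_def coef_poly; case: ltnP => // /Ws.
by move=> /matrixP/(_ a b); rewrite !mxE.
Qed.

(** As [A[x]] is free over [A] on the powers of [x], a vector has unique
    coordinates in [A[x] (x) A^q], namely its coefficients. *)
Lemma extend_polyC (A : comNzRingType) q (N : 'rV[A]_q -> Prop)
    (w : 'rV[{poly A}]_q) :
  submodule N -> extend polyC N w <-> forall j, N (coef_mx j w).
Proof.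
move=> subN; split=> [[s [b [u [Nu ->]]]] j|Nw].
  rewrite (_ : coef_mx j _ = \sum_i (b i)`_j *: u i); first exact: submodule_sum.
  apply/rowP => k; rewrite !mxE /= !summxE coef_sum.
  by apply: eq_bigr => i _; rewrite !mxE coefMC.
have [s ws] := coef_mx_bound w.
exists s, (fun j => 'X^j), (fun j => coef_mx j w); split=> //.
exact: poly_mx_expand.
Qed.

Lemma flat_polyC (A : comNzRingType) : flat (@polyC A).
Proof.
move=> r q C w wC; apply/extend_polyC => [|j].
  split=> [|a u v uC vC]; first exact: mul0mx.
  by rewrite mulmxDl -scalemxAl uC vC scaler0 addr0.
by rewrite -coef_mxMconst wC map_mx0.
Qed.

(** The predicate describes [A[x] (x) N] inside [A[x] (x) 'M_(d, m)]. *)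
Lemma all_res_coef k (A : comNzRingType) d m (N : 'M[A]_(d, m) -> Prop) :
  all_res k A -> submodule N ->
  has_res k (fun W : 'M[{poly A}]_(d, m) => forall j, N (coef_mx j W)).
Proof.
move=> resA [N0 ND].
have subN : submodule (fun u : 'rV_(d * m) => N (vec_mx u)).
  by split=> [|a u v Nu Nv]; rewrite ?linear0 // linearP; apply: ND.
apply: (has_res_inj (g := vec_mx) _ _
          (has_res_extend (@flat_polyC A) (resA _ _ subN))).
  by move=> w _ w0; rewrite -[w]vec_mxK w0 linear0.
move=> W; split=> [NW|[w [/extend_polyC Nw <-]] j].
  exists (mxvec W); rewrite /= mxvecK; split=> //; apply/extend_polyC => // j.
  by rewrite map_mxvec mxvecK.
by rewrite map_vec_mx; apply: Nw.
Qed.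

(** The union of the chain is finitely generated, and its finitely many
    generators already lie in one term. *)
Lemma submodule_chain_stationary k (A : comNzRingType) m
    (L : nat -> 'rV[A]_m -> Prop) :
  all_res k.+1 A -> (forall d, submodule (L d)) ->
  (forall d e c, (d <= e)%N -> L d c -> L e c) ->
  exists D, forall d c, L d c -> L D c.
Proof.
move=> resA subL homoL.
have [|r [f [Lf _]]] := resA m (fun c => exists d, L d c).
  split=> [|a u v [d Lu] [e Lv]]; first by exists 0; have [] := subL 0.
  exists (maxn d e); have [_] := subL (maxn d e); apply.
    by apply: homoL Lu; rewrite leq_maxl.
  by apply: homoL Lv; rewrite leq_maxr.
have /fin_all_exists[d Ld] (i : 'I_r) : exists d, L d (f (delta_mx 0 i)).
  by apply/Lf; exists (delta_mx 0 i).
exists (\max_i d i) => e c Lc.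
have [u <-] : exists u, f u = c by apply/Lf; exists e.
rewrite [u]row_sum_delta linear_sum.
rewrite (eq_bigr (fun i => u 0 i *: f (delta_mx 0 i))) => [|i _]; last first.
  exact: linearZ.
apply: submodule_sum => // i; apply: homoL (Ld i).
exact: leq_bigmax.
Qed.

(** * Presenting a module over A[x] by its elements of low degree *)

(** A [d x m] matrix [U] over [A] stands for the vector [powers d *m U] of
    polynomials of degree less than [d], the row [i] of [U] being its
    coefficient of ['X^i].  Over [A[x]], the matrices stand for the elements of
    [A[x] (x) A[x]_(<d)^m], and multiplication by [powers d] is the evaluation
    [p (x) g |-> p g]. *)
Definition powers {A : comNzRingType} d : 'rV[{poly A}]_d := \row_i 'X^i.

(** The inclusion of the vectors of degree less than [d] into those of degree
    less than [d.+1]. *)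
Definition low_rows {A : comNzRingType} d : 'M[A]_(d.+1, d) :=
  colsub (lift ord_max) 1%:M.

(** Multiplication by ['X], from the vectors of degree less than [d] to those of
    degree less than [d.+1]. *)
Definition high_rows {A : comNzRingType} d : 'M[A]_(d.+1, d) :=
  colsub (lift ord0) 1%:M.

Lemma coef_powersM (A : comNzRingType) d m j (W : 'M[{poly A}]_(d, m)) :
  coef_mx j (powers d *m W)
  = \sum_(i < d) if (j < i)%N then 0 else row i (coef_mx (j - i) W).
Proof.
apply/rowP => k; rewrite summxE !mxE /= coef_sum; apply: eq_bigr => i _.
by rewrite mxE coefXnM; case: ifP => _; rewrite !mxE.
Qed.

Lemma coef_powersM_const (A : comNzRingType) d m j (U : 'M[A]_(d, m)) :
  coef_mx j (powers d *m const_poly_mx U)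
  = if insub j is Some i then row i U else 0.
Proof.
rewrite coef_powersM; case: insubP => [i _ <-|].
  rewrite (bigD1 i) //= ltnn subnn coef_mx_const big1 ?addr0 // => l neq_li.
  case: ltngtP => // [lt_li|/val_inj eq_il]; last by rewrite eq_il eqxx in neq_li.
  by rewrite coef_mx_const subn_eq0 leqNgt lt_li row0.
rewrite -leqNgt => le_dj; rewrite big1 // => i _.
have lt_ij := leq_trans (ltn_ord i) le_dj.
by rewrite ltnNge (ltnW lt_ij) coef_mx_const subn_eq0 leqNgt lt_ij row0.
Qed.

Lemma powers_low (A : comNzRingType) d :
  powers d.+1 *m const_poly_mx (low_rows d) = powers d :> 'rV[{poly A}]_d.
Proof.
rewrite map_mxsub map_mx1 mulmx_colsub mulmx1.
by apply/rowP => i; rewrite !mxE lift_max.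
Qed.

Lemma powers_high (A : comNzRingType) d :
  powers d.+1 *m const_poly_mx (high_rows d) = 'X *: powers d :> 'rV[{poly A}]_d.
Proof.
rewrite map_mxsub map_mx1 mulmx_colsub mulmx1.
by apply/rowP => i; rewrite !mxE /= exprS.
Qed.

Lemma low_rows_lift (A : comNzRingType) d m (U : 'M[A]_(d, m)) i :
  row (lift ord_max i) (low_rows d *m U) = row i U.
Proof.
apply/rowP => k; rewrite !mxE (bigD1 i) //= !mxE eqxx mul1r big1 ?addr0 // => l.
by move=> neq_li; rewrite !mxE (inj_eq lift_inj) eq_sym (negPf neq_li) mul0r.
Qed.

Lemma low_rows_max (A : comNzRingType) d m (U : 'M[A]_(d, m)) :
  row ord_max (low_rows d *m U) = 0.
Proof.
apply/rowP => k; rewrite !mxE big1 // => l _.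
by rewrite !mxE (negPf (neq_lift _ _)) mul0r.
Qed.

Lemma low_rows_inj (A : comNzRingType) d m (U : 'M[A]_(d, m)) :
  low_rows d *m U = 0 -> U = 0.
Proof.
by move=> lowU; apply/row_matrixP => i; rewrite -low_rows_lift lowU !row0.
Qed.

Lemma low_rowsP (A : comNzRingType) d m (U : 'M[A]_(d.+1, m)) :
  row ord_max U = 0 -> exists U', U = low_rows d *m U'.
Proof.
move=> maxU; exists (rowsub (lift ord_max) U); apply/row_matrixP => i.
have [j ->|->] := unliftP ord_max i; last by rewrite maxU low_rows_max.
by rewrite low_rows_lift row_rowsub.
Qed.

(** The map [p (x) g |-> 'X p (x) g - p (x) 'X g]. *)
Definition shift_mx {A : comNzRingType} d : 'M[{poly A}]_(d.+1, d) :=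
  'X *: const_poly_mx (low_rows d) - const_poly_mx (high_rows d).

Lemma powers_shift (A : comNzRingType) d :
  powers d.+1 *m shift_mx d = 0 :> 'rV[{poly A}]_d.
Proof.
by rewrite mulmxBr -scalemxAr powers_low powers_high subrr.
Qed.

Lemma coef_shiftS (A : comNzRingType) d m j (W : 'M[{poly A}]_(d, m)) :
  coef_mx j.+1 (shift_mx d *m W)
  = low_rows d *m coef_mx j W - high_rows d *m coef_mx j.+1 W.
Proof.
rewrite mulmxBl map_mxB -scalemxAl -['X]expr1 coef_mxXn subn1.
by rewrite !coef_mx_constM.
Qed.

Lemma coef_shift0 (A : comNzRingType) d m (W : 'M[{poly A}]_(d, m)) :
  coef_mx 0 (shift_mx d *m W) = - (high_rows d *m coef_mx 0 W).
Proof.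
rewrite mulmxBl map_mxB -scalemxAl -['X]expr1 coef_mxXn /=.
by rewrite coef_mx_constM sub0r.
Qed.

(** The highest coefficient of [W] survives in the next one of
    [shift_mx d *m W]. *)
Lemma shift_inj (A : comNzRingType) d m (W : 'M[{poly A}]_(d, m)) :
  shift_mx d *m W = 0 -> W = 0.
Proof.
move=> shiftW; apply: coef_mx_eq0.
have [s] := coef_mx_bound W.
elim: s => [|s IHs] Ws; first by move=> j; apply: Ws.
apply: IHs => j; rewrite leq_eqVlt => /predU1P[<-{j}|]; last exact: Ws.
apply: low_rows_inj; have := coef_shiftS s W.
by rewrite shiftW map_mx0 (Ws s.+1) // mulmx0 subr0.
Qed.

(** Let [W] be a relation with highest coefficient [W_s].  The coefficient of
    degree [s + D] of the relation [powers D.+1 *m W = 0] has no contribution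
    but the last row of [W_s], which therefore vanishes: [W_s] is the
    inclusion of some [U] of degree less than [D], which lies in [N1] because
    [N1] consists of the elements of [N0] of degree less than [D].
    Subtracting from [W] the image of ['X^(s-1) U] then lowers its degree.  When
    [s = 0], the relation says that [W] is zero. *)
Lemma shift_exact (A : comNzRingType) D m
    (N1 : 'M[A]_(D, m) -> Prop) (N0 : 'M[A]_(D.+1, m) -> Prop)
    (W : 'M[{poly A}]_(D.+1, m)) :
  submodule N0 ->
  (forall U, N1 U <-> N0 (low_rows D *m U)) ->
  (forall U, N1 U -> N0 (high_rows D *m U)) ->
  (forall j, N0 (coef_mx j W)) /\ powers D.+1 *m W = 0
  <-> exists V, (forall j, N1 (coef_mx j V)) /\ shift_mx D *m V = W.
Proof.
move=> subN0 N1low N1high.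
have N10 : N1 0 by apply/N1low; rewrite mulmx0; case: subN0.
have N0shift V : (forall j, N1 (coef_mx j V)) ->
    forall j, N0 (coef_mx j (shift_mx D *m V)).
  move=> N1V [|j].
    by rewrite coef_shift0 -scaleN1r; apply/(submoduleZ _ subN0)/N1high.
  by rewrite coef_shiftS; apply: submoduleB; [|apply/N1low|apply: N1high].
split=> [[N0W powW]|[V [N1V <-]]]; last first.
  by split; [exact: N0shift | rewrite mulmxA powers_shift mul0mx].
have [s] := coef_mx_bound W.
elim: s => [|s IHs] in W N0W powW * => Ws.
  exists 0; rewrite mulmx0 (coef_mx_eq0 (W := W)) => [|j]; last exact: Ws.
  by split=> // j; rewrite map_mx0.
have [U WU] : exists U, coef_mx s W = low_rows D *m U.
  apply: low_rowsP; have := coef_powersM (s + D) W.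
  rewrite powW map_mx0 big_ord_recr /= big1 => [|i _].
    by rewrite add0r ltnNge leq_addl addnK.
  case: ltnP => // _; rewrite Ws ?row0 //.
  by have := ltn_ord i; lia.
case: s => [|s] in IHs Ws WU *.
  have W0 : W = const_poly_mx (coef_mx 0 W).
    by rewrite {1}(poly_mx_expand Ws) big_ord1 expr0 scale1r.
  exists 0; rewrite mulmx0; split=> [j|]; first by rewrite map_mx0.
  rewrite W0 (_ : coef_mx 0 W = 0) ?map_mx0 //; apply/row_matrixP => i.
  have := coef_powersM_const i (coef_mx 0 W).
  by rewrite -W0 powW map_mx0 valK row0 => <-.
have N1U : N1 U by apply/N1low; rewrite -WU.
pose V := 'X^s *: const_poly_mx U.
have coefV j : coef_mx j V = if j == s then U else 0.
  by rewrite coef_mxXn coef_mx_const subn_eq0; case: ltngtP.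
have N1V j : N1 (coef_mx j V) by rewrite coefV; case: ifP.
have [j|||V' [N1V' eV']] := IHs (W - shift_mx D *m V).
- by rewrite coef_mxB; apply: submoduleB => //; apply: N0shift.
- by rewrite mulmxBr powW mulmxA powers_shift mul0mx subrr.
- case=> // j; rewrite coef_mxB coef_shiftS !coefV ltnS leq_eqVlt eq_sym.
  move=> /predU1P[->|lt_sj].
    by rewrite eqxx WU gtn_eqF // mulmx0 subr0 subrr.
  by rewrite Ws // !gtn_eqF ?mulmx0 ?subr0 // ltnW.
exists (V' + V); split=> [j|]; last by rewrite mulmxDr eV' subrK.
rewrite coef_mxD; apply/N1low; rewrite mulmxDr.
by apply: submoduleD => //; apply/N1low.
Qed.

(** * Passing from A to A[x] *)

(** Since [c] may vanish, these are the leading coefficients in degree exactly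
    [d], together with [0]; this is what makes them a submodule. *)
Definition lead_coefs (A : comNzRingType) m (N : 'rV[{poly A}]_m -> Prop) d
    (c : 'rV[A]_m) : Prop :=
  exists g, [/\ N g, forall j, (d < j)%N -> coef_mx j g = 0 & coef_mx d g = c].

Lemma submodule_lead_coefs (A : comNzRingType) m
    (N : 'rV[{poly A}]_m -> Prop) d :
  submodule N -> submodule (lead_coefs N d).
Proof.
move=> subN; split=> [|a _ _ [g [Ng g0 <-]] [h [Nh h0 <-]]].
  by exists 0; rewrite map_mx0; split=> [|j _|//]; [case: subN | rewrite map_mx0].
have coefZ j : coef_mx j (a%:P *: g) = a *: coef_mx j g.
  by apply/matrixP => i k; rewrite !mxE /= coefCM.
exists (a%:P *: g + h); split=> [|j ltj|]; first by case: subN => _; apply.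
  by rewrite coef_mxD coefZ g0 // h0 // scaler0 addr0.
by rewrite coef_mxD coefZ.
Qed.

Lemma lead_coefs_homo (A : comNzRingType) m
    (N : 'rV[{poly A}]_m -> Prop) d e c :
  submodule N -> (d <= e)%N -> lead_coefs N d c -> lead_coefs N e c.
Proof.
move=> subN le_de [g [Ng g0 <-]]; exists ('X^(e - d) *: g); split=> [|j lt_ej|].
- exact: submoduleZ.
- by rewrite coef_mxXn; case: ifP => // _; rewrite g0 //; lia.
- by rewrite coef_mxXn ltnNge leq_subr subKn.
Qed.

Lemma powers_mul_coefs (A : comNzRingType) d m (v : 'rV[{poly A}]_m) :
  (forall j, (d <= j)%N -> coef_mx j v = 0) ->
  powers d *m const_poly_mx (\matrix_(i < d) coef_mx i v) = v.
Proof.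
move=> v0; apply/subr0_eq/coef_mx_eq0 => j; rewrite coef_mxB coef_powersM_const.
case: insubP => [i _ <-|]; first by rewrite rowK subrr.
by rewrite -leqNgt => /v0->; rewrite subrr.
Qed.

(** Beyond degree [D], where the leading coefficients of [N] are stationary, an
    element of [N] can be reduced by a multiple ['X^(s - D) g] of some [g] in
    [N] of degree at most [D]; this makes the evaluation map onto. *)
Lemma all_res_poly k (A : comNzRingType) :
  all_res k.+1 A -> all_res k.+2 {poly A}.
Proof.
move=> resA m N subN.
have [D leadD] := submodule_chain_stationary resA
  (fun d => submodule_lead_coefs d subN)
  (fun d e c => lead_coefs_homo (d := d) (e := e) (c := c) subN).
pose low d (U : 'M[A]_(d, m)) := N (powers d *m const_poly_mx U).
have sub_low d : submodule (low d).
  rewrite /low; split=> [|a U V NU NV].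
    by rewrite map_mx0 mulmx0; case: subN.
  by rewrite map_mxD map_mxZ mulmxDr -scalemxAr; case: subN => _; apply.
apply: (has_res_quotient
  (phi := mulmx (shift_mx D)) (psi := mulmx (powers D.+1)) _ _ _
  (all_res_coef resA (sub_low D))
  (has_resS (all_res_coef resA (sub_low D.+1)))).
- by move=> W _; apply: shift_inj.
- move=> W; apply: shift_exact => // U; rewrite /low.
    by rewrite map_mxM mulmxA powers_low.
  by rewrite map_mxM mulmxA powers_high -scalemxAl; apply: submoduleZ.
move=> v; split=> [|[W [lowW <-]]]; last first.
  have [s /poly_mx_expand->] := coef_mx_bound W.
  rewrite linear_sum (eq_bigr (fun j : 'I_s => 'X^j *: (powers D.+1 *m
    const_poly_mx (coef_mx j W)))) => [|j _]; last exact: linearZ.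
  by apply: submodule_sum => // j; apply: lowW.
have [s] := coef_mx_bound v.
suff base w : (forall j, (D < j)%N -> coef_mx j w = 0) -> N w ->
    exists W, (forall j, low D.+1 (coef_mx j W)) /\ powers D.+1 *m W = w.
  elim: s v => [|s IHs] v vs Nv; first by apply: base => // j _; apply: vs.
  have [le_sD|lt_Ds] := leqP s D.
    by apply: base => // j lt_Dj; apply: vs; apply: leq_ltn_trans lt_Dj.
  have [g [Ng g0 gv]] : lead_coefs N D (coef_mx s v).
    by apply: (leadD s); exists v; split.
  have [W [lowW eW]] := base g g0 Ng.
  have [||W' [lowW' eW']] := IHs (v - 'X^(s - D) *: g).
  - move=> j; rewrite coef_mxB coef_mxXn leq_eqVlt => /predU1P[<-|lt_sj].
      by rewrite ltnNge leq_subr subKn ?gv ?subrr // ltnW.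
    by rewrite vs // sub0r; case: ifP => _; rewrite ?g0 ?oppr0 //; lia.
  - by apply: submoduleB => //; apply: submoduleZ.
  exists (W' + 'X^(s - D) *: W); split=> [j|]; last first.
    by rewrite /= mulmxDr -scalemxAr eW eW' subrK.
  rewrite coef_mxD; apply: submoduleD => //; rewrite coef_mxXn.
  by case: ifP => // _; case: (sub_low D.+1).
move=> w0 Nw; have wE := powers_mul_coefs w0.
exists (const_poly_mx (\matrix_(i < D.+1) coef_mx i w)); split=> [j|//].
rewrite coef_mx_const; case: ifP => _; first by rewrite /low wE.
by case: (sub_low D.+1).
Qed.

(** * Principal ideal domains *)

(** Induction on the rank [m].  The first coordinates of the elements of [N]
    form an ideal, generated by [a], and the elements with first coordinate zero
    form a submodule [N'] of [R^m].  If [a = 0] then [N = N']; otherwise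
    [N] is the direct sum of [N'] and of the line through an element with first
    coordinate [a], which is free because [R] is a domain. *)
Lemma all_res_pid (R : idomainType) : is_pid R -> all_res 1 R.
Proof.
move=> pidR; elim=> [|m IHm] N subN.
  exists 0, idfun; split=> [v|v] /=; last by rewrite (thinmx0 v).
  by rewrite (thinmx0 v); split=> [_|_]; [exists 0 | case: subN].
rewrite -[m.+1]/(1 + m)%N in N subN *.
have sub_tail : submodule (fun w : 'rV_m => N (row_mx 0 w)).
  split=> [|a u v Nu Nv]; first by rewrite row_mx0; case: subN.
  have [_ /(_ a _ _ Nu Nv)] := subN.
  by rewrite scale_row_mx add_row_mx scaler0 addr0.
have [r [f [tailf injf]]] := IHm _ sub_tail.
have [|a aP] := pidR (fun x => exists w : 'rV_m, N (row_mx x%:M w)).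
  split=> [|x y [u Nu] [v Nv]|c x [u Nu]].
  - by exists 0; rewrite raddf0 row_mx0; case: subN.
  - exists (u + v); rewrite raddfD -add_row_mx; exact: submoduleD.
  - by exists (c *: u); rewrite -scale_scalar_mx -scale_row_mx; apply: submoduleZ.
have [a0|a_neq0] := eqVneq a 0.
  apply: (has_res_inj (g := mulmxr (row_mx 0 1%:M : 'M_(m, 1 + m)))
           _ _ (IHm _ sub_tail)) => [w _|v] /=.
    by rewrite mul_mx_row mulmx0 mulmx1 -row_mx0 => /eq_row_mx[].
  split=> [Nv|[w [Nw <-]]]; last by rewrite mul_mx_row mulmx0 mulmx1.
  exists (rsubmx v); rewrite mul_mx_row mulmx0 mulmx1.
  have v0 : lsubmx v = 0.
    have [c] : exists c, (lsubmx v) 0 0 = c * a.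
      apply/aP; exists (rsubmx v).
      by rewrite -mx11_scalar hsubmxK.
    by rewrite a0 mulr0 => v00; rewrite [lsubmx _]mx11_scalar v00 raddf0.
  by rewrite -v0 hsubmxK.
have [w0 Nw0] : exists w : 'rV_m, N (row_mx a%:M w).
  by apply/aP; exists 1; rewrite mul1r.
have hE (u : 'rV_(1 + r)) : u *m block_mx a%:M w0 0 (lin1_mx f)
    = (lsubmx u 0 0) *: row_mx a%:M w0 + row_mx 0 (f (rsubmx u)).
  rewrite -[u in LHS]hsubmxK [lsubmx u in LHS]mx11_scalar mul_row_block.
  rewrite !mul_scalar_mx mulmx0 mul_rV_lin1 addr0 scale_row_mx add_row_mx.
  by rewrite addr0.
exists (1 + r)%N, (mulmxr (block_mx a%:M w0 0 (lin1_mx f))).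
split=> [v|u] /=; last first.
  rewrite hE scale_row_mx add_row_mx addr0; split=> [|->]; last first.
    by rewrite !linear0 mxE !scale0r addr0 row_mx0.
  rewrite -row_mx0 => /eq_row_mx[/matrixP/(_ 0 0)].
  rewrite !mxE eqxx mulr1n => /eqP.
  rewrite mulf_eq0 (negPf a_neq0) orbF => /eqP u0.
  rewrite u0 scale0r add0r => /injf u1.
  rewrite -[u]hsubmxK u1 [lsubmx u]mx11_scalar [lsubmx u 0 0]mxE u0.
  by rewrite raddf0 row_mx0.
split=> [Nv|[u <-]]; last first.
  rewrite hE; apply: submoduleD => //; first exact: submoduleZ.
  by apply/tailf; exists (rsubmx u).
have [c vc] : exists c, (lsubmx v) 0 0 = c * a.
  by apply/aP; exists (rsubmx v); rewrite -mx11_scalar hsubmxK.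
have vE : v - c *: row_mx a%:M w0
    = row_mx 0 (rsubmx v - c *: w0) :> 'rV_(1 + m).
  rewrite -[v in LHS]hsubmxK [lsubmx _]mx11_scalar vc.
  by rewrite scale_row_mx opp_row_mx add_row_mx scale_scalar_mx subrr.
have [u fu] : exists u, f u = rsubmx v - c *: w0.
  by apply/tailf; rewrite -vE; apply: submoduleB => //; apply: submoduleZ.
exists (row_mx c%:M u); rewrite hE row_mxKl row_mxKr fu -vE.
by rewrite mxE eqxx mulr1n addrC subrK.
Qed.

(** * From one variable to several *)

(** Bijective morphisms are flat, so this is again a base change. *)
Lemma all_res_iso k (A B : comNzRingType) (f : {rmorphism A -> B})
    (g : B -> A) :
  cancel f g -> cancel g f -> all_res k A -> all_res k B.
Proof.
move=> fK gK resA m N subN.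
have map_fK q r (U : 'M_(q, r)) : map_mx g (map_mx f U) = U.
  by apply/matrixP => i j; rewrite !mxE fK.
have map_gK q r (U : 'M_(q, r)) : map_mx f (map_mx g U) = U.
  by apply/matrixP => i j; rewrite !mxE gK.
have flat_f : flat f.
  move=> r q C w wC; exists 1, (fun=> 1), (fun=> map_mx g w); split=> [_|].
    by apply: (can_inj (map_fK _ _)); rewrite map_mxM map_gK wC map_mx0.
  by rewrite big_ord1 scale1r map_gK.
have subfN : submodule (fun u : 'rV_m => N (map_mx f u)).
  split=> [|a u v Nu Nv]; first by rewrite map_mx0; case: subN.
  by rewrite map_mxD map_mxZ; case: subN => _; apply.
apply: has_res_ext (has_res_extend flat_f (resA m _ subfN)) => v.
split=> [[s [b [u [Nu ->]]]]|Nv]; first exact: submodule_sum.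
exists 1, (fun=> 1), (fun=> map_mx g v); split=> [_|]; first by rewrite map_gK.
by rewrite big_ord1 scale1r map_gK.
Qed.

(** Evaluation at the last variable, as a composite that inherits a morphism
    structure from its factors; it is the inverse of [muni]. *)
Definition multi_of_uni (R : comNzRingType) (n : nat) :
    {poly {mpoly R[n]}} -> {mpoly R[n.+1]} :=
  horner_eval 'X_ord_max \o map_poly (@mwiden n R).

HB.instance Definition _ (R : comNzRingType) (n : nat) :=
  GRing.RMorphism.on (@multi_of_uni R n).

Definition drop_max n (m : 'X_{1..n.+1}) : 'X_{1..n} :=
  [multinom m (widen_ord (leqnSn n) i) | i < n].

Lemma multi_of_uni_monomial (R : comNzRingType) n (c : {mpoly R[n]}) k :
  multi_of_uni (c *: 'X^k) = mwiden c * 'X_ord_max ^+ k.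
Proof.
by rewrite /multi_of_uni /= map_polyZ map_polyXn /horner_eval !hornerE.
Qed.

Lemma muniX (R : comNzRingType) n (m : 'X_{1..n.+1}) :
  muni ('X_[m] : {mpoly R[n.+1]}) = 'X_[drop_max m] *: 'X^(m ord_max).
Proof. by rewrite muniE msuppX big_seq1 mcoeffX eqxx scale1r. Qed.

Lemma muniK (R : comNzRingType) n : cancel (@muni n R) (@multi_of_uni R n).
Proof.
move=> p; rewrite [in RHS](mpolyE p) [in LHS](mpolyE p).
rewrite (raddf_sum (@muni n R)) raddf_sum /=.
apply: eq_bigr => m _; rewrite muniZ muniX scalerA multi_of_uni_monomial.
rewrite mul_mpolyC mwidenZ mwidenX -scalerAl mpolyXn -mpolyXD.
congr (_ *: 'X_[_]); apply/mnmP => i; rewrite mnmDE mulmnE mnm1E.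
have [<-|neq] := eqVneq ord_max i; first by rewrite mnmwiden_ordmax mul1n.
have lt_in : (i < n)%N.
  by move: neq (ltn_ord i); rewrite -val_eqE /=; lia.
have -> : i = widen_ord (leqnSn n) (Ordinal lt_in) by apply/val_inj.
by rewrite mnmwiden_widen mnmE mul0n addn0.
Qed.

Lemma multi_of_uniK (R : comNzRingType) n :
  cancel (@multi_of_uni R n) (@muni n R).
Proof.
move=> p; rewrite -[in RHS](coefK p) poly_def -[in LHS](coefK p) poly_def.
rewrite !raddf_sum /=; apply: eq_bigr => k _.
rewrite multi_of_uni_monomial rmorphM rmorphXn /= muniX.
have -> : @drop_max n U_(ord_max) = 0%MM.
  apply/mnmP => i; rewrite mnmE mnm1E mnm0E -val_eqE /=.
  by rewrite gtn_eqF // ltn_ord.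
rewrite mnm1E eqxx mpolyX0 scale1r; set c := p`_k.
suff -> : muni (mwiden c) = c%:P by rewrite mul_polyC.
rewrite {1}(mpolyE c) [in RHS](mpolyE c) (raddf_sum (@mwiden n R)).
rewrite (raddf_sum (@muni n R)) raddf_sum /=.
apply: eq_bigr => m _; rewrite mwidenZ mwidenX muniZ muniX mnmwiden_ordmax.
rewrite expr0 scalerA -mul_mpolyC -alg_polyC; congr (_ * 'X_[_] *: _).
by apply/mnmP => i; rewrite mnmE mnmwiden_widen.
Qed.

Lemma all_res_mpoly (R : idomainType) n : is_pid R -> all_res n.+1 {mpoly R[n]}.
Proof.
move=> pidR; elim: n => [|n IHn].
  apply: (all_res_iso (f := @mpolyC 0 R) (g := mcoeff 0%MM)) (all_res_pid pidR).
    by move=> c; rewrite mcoeffC eqxx mulr1.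
  by move=> p; apply/esym/nvar0_mpolyC.
exact: (all_res_iso (@multi_of_uniK R n) (@muniK R n) (all_res_poly IHn)).
Qed.

(** * Complexes *)

Lemma finite_free_rV (S : comNzRingType) r : finite_free 'rV[S]_r.
Proof.
exists r, (fun i => delta_mx 0 i); split=> [x|c c0 i].
  by exists (x 0); apply: row_sum_delta.
have := congr1 (fun v : 'rV_r => v 0 i) c0; rewrite mxE summxE (bigD1 i) //=.
rewrite !mxE !eqxx mulr1 big1 ?addr0 // => j neq_ji.
by rewrite !mxE eqxx eq_sym (negPf neq_ji) mulr0.
Qed.

(** Splicing the successive presentations: the differential [F i.+1 -> F i] is the
    surjection onto the kernel of the previous one, followed by its inclusion. *)
Lemma has_res_complex (S : comNzRingType) k (V : lmodType S) (N : V -> Prop) :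
  has_res k N ->
  exists (F : nat -> lmodType S) (d : forall i, {linear F i.+1 -> F i})
      (eps : {linear F 0%N -> V}),
    [/\ forall i, finite_free (F i),
        forall i, (k <= i)%N -> forall x : F i, x = 0,
        forall v, N v <-> exists x, eps x = v,
        forall x, eps x = 0 <-> exists z, d 0%N z = x
      & forall i x, d i x = 0 <-> exists z, d i.+1 z = x].
Proof.
elim: k => [|k IHk] in V N *.
  move=> N0; have rV0 (x : 'rV[S]_0) : x = 0 by rewrite (thinmx0 x).
  exists (fun=> 'rV[S]_0), (fun=> idfun), \0; split=> [i|//|v|x|i x] //=.
  - exact: finite_free_rV.
  - by rewrite N0; split=> [->|[_ <-]] //; exists 0.
  - by split=> // _; exists x.
  - by split=> // _; exists x.
move=> [r [f [Nf /IHk[F [d [eps [freeF F0 epsP exact0 exactS]]]]]]].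
pose G i : lmodType S := if i is j.+1 then F j else 'rV[S]_r.
pose dG i : {linear G i.+1 -> G i} :=
  match i return {linear G i.+1 -> G i} with 0 => eps | j.+1 => d j end.
exists G, dG, f.
split=> [[|i]|[|i]|||[|i]] //; last exact: exactS.
- exact: finite_free_rV.
- exact: freeF.
- exact: F0.
Qed.

(** A generating family is a surjection from a free module onto [M]; resolving
    its kernel, a submodule of a free module, costs one more step. *)
Lemma has_res_finitely_generated (S : comNzRingType) k (M : lmodType S) :
  all_res k S -> finitely_generated M -> has_res k.+1 (fun _ : M => True).
Proof.
move=> resS [r [b spanb]].
pose f (u : 'rV[S]_r) : M := \sum_(i < r) u 0 i *: b i.
have f_lin : linear f.
  move=> a u v; rewrite /f scaler_sumr -big_split; apply: eq_bigr => i _ /=.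
  by rewrite !mxE scalerDl scalerA.
pose fL : {linear 'rV[S]_r -> M} :=
  HB.pack f (GRing.isLinear.Build _ _ _ _ f f_lin).
exists r, fL; split=> [v|].
  have [c ->] := spanb v; split=> // _; exists (\row_i c i).
  by rewrite /= /f; apply: eq_bigr => i _; rewrite mxE.
apply: resS; split=> [|a u v fu fv]; first exact: linear0.
by rewrite linearP fu fv scaler0 addr0.
Qed.

Unset Implicit Arguments.
Set Strict Implicit.

Theorem theorem4p6 (R : idomainType) (n : nat) (M : lmodType {mpoly R[n]})
    (hR : is_pid R) (hM : finitely_generated M) :
  exists (p : nat) (F : nat -> lmodType {mpoly R[n]})
      (d : forall i : nat, {linear F i.+1 -> F i})
      (eps : {linear F 0%N -> M}),
    (p <= n.+1)%N /\ is_free_resolution p d eps.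
Proof.
have [F [d [eps [freeF F0 epsP exact0 exactS]]]] :=
  has_res_complex (has_res_finitely_generated (all_res_mpoly hR) hM).
exists n.+1, F, d, eps; split=> //; split=> // y.
by apply/epsP.
Qed.
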